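(* Let $p\in\mathbb N$, let $\mathbf f^{[\nu]}\in\mathcal C^{p+1}(\mathbb R^d,\mathbb R^d)$ be Lipschitz continuous for $\nu=1,\dots,N$, and let the matrices $\mathbf A^{[\nu]}(\mathbf y^n,\Delta t)=(a_{ij}^{[\nu]}(\mathbf y^n,\Delta t))_{i,j=1,\dots,s}$ of the NSARK method (see context) satisfy $\mathbf A^{[\nu]}(\mathbf y^n,\Delta t)=\mathcal O(1)$ component-wise as $\Delta t\to0$, for $\nu=1,\dots,N$. If the stage equations of the NSARK method possess a solution for small enough $\Delta t$, then the NSARK method is of order at least $p$ if and only if $$u(\tau,\mathbf y^n,\Delta t)=\frac{1}{\gamma(\tau)}+\mathcal O(\Delta t^{\,p+1-|\tau|})\quad\text{as }\Delta t\to0,\qquad\text{for all }\tau\in NT_p.$$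
   Context: Autonomous initial value problem: $\mathbf y'=\mathbf f(\mathbf y)=\sum_{\nu=1}^N\mathbf f^{[\nu]}(\mathbf y)$, $\mathbf y\in\mathbb R^d$. NSARK method (non-standard additive Runge--Kutta method) with $s$ stages and step size $\Delta t>0$: $$\mathbf y^{(i)}=\mathbf y^n+\Delta t\sum_{j=1}^s\sum_{\nu=1}^N a_{ij}^{[\nu]}(\mathbf y^n,\Delta t)\,\mathbf f^{[\nu]}(\mathbf y^{(j)}),\ i=1,\dots,s,\qquad \mathbf y^{n+1}=\mathbf y^n+\Delta t\sum_{j=1}^s\sum_{\nu=1}^N b_{j}^{[\nu]}(\mathbf y^n,\Delta t)\,\mathbf f^{[\nu]}(\mathbf y^{(j)}),$$ where the coefficients are real numbers that may depend on $\mathbf y^n$ and $\Delta t$ (possibly implicitly). Order: the method is of order at least $p$ if, starting from exact data $\mathbf y^n=\mathbf y(t_n)$, one step satisfies $\mathbf y^{n+1}-\mathbf y(t_n+\Delta t)=\mathcal O(\Delta t^{p+1})$ as $\Delta t\to0$. As usual for order conditions, the equivalence is understood for arbitrary right-hand sides $\mathbf f^{[\nu]}$ of the stated smoothness (i.e. elementary differentials of distinct colored trees are regarded as linearly independent). Colored trees: $NT$ is the set of all (unordered) rooted trees whose nodes each carry a color in $\{1,\dots,N\}$; $|\tau|$ is the number of nodes of $\tau$ and $NT_q=\{\tau\in NT: |\tau|\le q\}$. The one-node tree of color $\mu$ is $\bullet^{[\mu]}$, and $[\tau_1,\dots,\tau_l]^{[\mu]}$ is the tree with root color $\mu$ and children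 $\tau_1,\dots,\tau_l$ (connected components after removing the root). Density: $\gamma(\bullet^{[\mu]})=1$, $\gamma([\tau_1,\dots,\tau_l]^{[\mu]})=|\tau|\prod_{i=1}^l\gamma(\tau_i)$, where $\tau=[\tau_1,\dots,\tau_l]^{[\mu]}$. With the Kronecker delta $\delta_{\nu\mu}$, $u$ is defined through $$u(\tau,\mathbf y^n,\Delta t)=\sum_{\nu=1}^N\sum_{i=1}^s b_i^{[\nu]}(\mathbf y^n,\Delta t)\,g_i^{[\nu]}(\tau,\mathbf y^n,\Delta t),\qquad d_i(\tau,\mathbf y^n,\Delta t)=\sum_{\nu=1}^N\sum_{j=1}^s a_{ij}^{[\nu]}(\mathbf y^n,\Delta t)\,g_j^{[\nu]}(\tau,\mathbf y^n,\Delta t),$$ $$g_i^{[\nu]}(\bullet^{[\mu]},\mathbf y^n,\Delta t)=\delta_{\nu\mu},\qquad g_i^{[\nu]}([\tau_1,\dots,\tau_l]^{[\mu]},\mathbf y^n,\Delta t)=\delta_{\nu\mu}\prod_{j=1}^l d_i(\tau_j,\mathbf y^n,\Delta t).$$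
   Formalization: The formal theorem also assumes the weights b^[ν](y^n,Δt) = O(1) as Δt→0; without it the claim fails, e.g. f(y)=y, y^n=1, p=1, s=2, a_21=1 (other a_ij=0), b=(1−Δt^{-3}, Δt^{-3}): u(•)=1 but y^{n+1}=1+Δt+1/Δt. *)

(* Defs.v *)
From HB Require Import structures.
From mathcomp Require Import all_boot all_order all_algebra.
From mathcomp Require Import all_classical all_reals all_analysis.

Set Implicit Arguments.
Unset Strict Implicit.
Unset Printing Implicit Defensive.

Import Order.TTheory GRing.Theory Num.Theory.
Import numFieldNormedType.Exports.

Local Open Scope classical_set_scope.
Local Open Scope ring_scope.

(* A colored tree is represented by choosing an order of the children of each
   node; two representatives denote the same unordered tree iff they are
   related by [same_tree]. The functions of a tree defined below do not depend
   on the order of the children (for [elem_diff]: by the symmetry of the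
   derivatives of a C^k function), so that quantifying over representatives is
   quantifying over unordered trees. Only a statement about *distinct* trees
   has to mention [same_tree]. *)
Inductive ctree (N : nat) : Type :=
  CNode of 'I_N & seq (ctree N).

Inductive same_tree (N : nat) : ctree N -> ctree N -> Prop :=
| same_refl t : same_tree t t
| same_trans t1 t2 t3 :
    same_tree t1 t2 -> same_tree t2 t3 -> same_tree t1 t3
| same_swap mu s1 s2 t1 t2 :
    same_tree (CNode mu (s1 ++ t1 :: t2 :: s2))
              (CNode mu (s1 ++ t2 :: t1 :: s2))
| same_child mu s1 s2 t1 t2 :
    same_tree t1 t2 ->
    same_tree (CNode mu (s1 ++ t1 :: s2)) (CNode mu (s1 ++ t2 :: s2)).

Fixpoint tree_size (N : nat) (t : ctree N) : nat :=
  let: CNode _ ts := t in (sumn [seq tree_size t' | t' <- ts]).+1.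

Fixpoint density (N : nat) (t : ctree N) : nat :=
  let: CNode _ ts := t in
  (tree_size t * \prod_(k <- [seq density t' | t' <- ts]) k)%N.

(* g(h) = O(e(h)) as the step size h > 0 tends to 0. *)
Definition is_bigO (R : realType) (W : normedModType R)
    (g : R -> W) (e : R -> R) : Prop :=
  let F := (0 : R)^'+ in g =O_F e.

Section Coefficients.
Variables (R : realType) (N s : nat).
Variables (A : 'I_N -> 'M[R]_s) (b : 'I_N -> 'rV[R]_s).

Fixpoint stage_weight (t : ctree N) (nu : 'I_N) (i : 'I_s) : R :=
  let: CNode mu ts := t in
  (nu == mu)%:R *
  \prod_(c <- [seq \sum_(nu' < N) \sum_(j < s)
                     A nu' i j * stage_weight t' nu' j | t' <- ts]) c.

Definition step_weight (t : ctree N) : R :=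
  \sum_(nu < N) \sum_(i < s) b nu 0 i * stage_weight t nu i.

End Coefficients.

Section Method.
Variables (R : realType) (d N s : nat).
Notation V := 'rV[R]_d.

(* By the finite dimension of V, a C^(k+1) map is a differentiable map all of
   whose directional derivatives are C^k. *)
Fixpoint class_C (k : nat) (g : V -> V) : Prop :=
  if k is k'.+1 then
    (forall x, differentiable g x) /\ (forall v, class_C k' ('D_v g))
  else continuous g.

(* The k-th derivative of g at x, as a multilinear map applied to the k vectors
   listed in vs. *)
Definition iter_derive (g : V -> V) (vs : seq V) (x : V) : V :=
  foldr (fun v (g' : V -> V) => 'D_v g') g vs x.

Variable f : 'I_N -> V -> V.

Definition rhs (y : V) : V := \sum_(nu < N) f nu y.

Fixpoint elem_diff (t : ctree N) (x : V) : V :=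
  let: CNode mu ts := t in
  iter_derive (f mu) [seq elem_diff t' x | t' <- ts] x.

Definition independent_elem_diffs (p : nat) (x : V) : Prop :=
  forall (m : nat) (t : 'I_m -> ctree N),
    (forall k, (tree_size (t k) <= p)%N) ->
    (forall k l, same_tree (t k) (t l) -> k = l) ->
    free [tuple elem_diff (t k) x | k < m].

Definition exact_solution_near (t0 : R) (y : R -> V) : Prop :=
  \forall t \near t0, is_derive t (1 : R) y (rhs (y t)).

(* The coefficients are functions of the current value y^n and the step size.
   Methods with implicitly given coefficients, e.g. depending on f or on the
   stages, are covered by taking for A and b the resulting coefficients. *)
Variables (A : 'I_N -> V -> R -> 'M[R]_s) (b : 'I_N -> V -> R -> 'rV[R]_s).

Definition stage_equations (yn : V) (h : R) (Y : 'I_s -> V) : Prop :=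
  forall i : 'I_s,
    Y i = yn + h *: \sum_(j < s) \sum_(nu < N) A nu yn h i j *: f nu (Y j).

Definition nsark_step (yn : V) (h : R) (ynext : V) : Prop :=
  exists2 Y : 'I_s -> V, stage_equations yn h Y &
    ynext = yn + h *: \sum_(j < s) \sum_(nu < N) b nu yn h 0 j *: f nu (Y j).

(* [y] is the exact solution, which provides the exact data y^n = y(t_n). *)
Definition order_at_least (p : nat) (y : R -> V) (tn : R) : Prop :=
  forall ynext : R -> V,
    (\forall h \near 0^'+, nsark_step (y tn) h (ynext h)) ->
    is_bigO (fun h => ynext h - y (tn + h)) (fun h => h ^+ p.+1).

Definition order_conditions (p : nat) (yn : V) : Prop :=
  forall t : ctree N, (tree_size t <= p)%N ->
    is_bigO (fun h => step_weight (fun nu => A nu yn h) (fun nu => b nu yn h) t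
                      - (density t)%:R^-1)
            (fun h => h ^+ (p.+1 - tree_size t)).

End Method.

(* Main.v *)
Require Import Defs.
From HB Require Import structures.
From mathcomp Require Import all_boot all_order all_algebra.
From mathcomp Require Import all_classical all_reals all_analysis.
From mathcomp Require Import ring lra.

Set Implicit Arguments.
Unset Strict Implicit.
Unset Printing Implicit Defensive.

Import Order.TTheory GRing.Theory Num.Theory.
Import numFieldNormedType.Exports.

Local Open Scope classical_set_scope.
Local Open Scope ring_scope.

(** One step of the method and the exact flow both have an expansion in powers
of the step size h whose coefficients are elementary differentials at y^n, and
the order conditions compare the two expansions tree by tree.

The expansions are written over trees whose children are ordered, with the
weight [tree_coef], the product over the nodes of 1 / (number of children)!.
If Y = x + S + O(h^(q+1)) and S is a finite sum of terms c_i u_i with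
c_i = O(h), then the k-th Taylor term D^k f(x)(S, ..., S) / k! expands by
multilinearity into one term per word of length k in the letters i, and a word
of trees is the list of children of a new root. Thus no symmetry coefficient
ever appears, and [comp_expansion], specialised in [bseries_comp], turns an
expansion of Y up to order q over [trees N q] into one of f(Y) over words of
such trees. Multiplying by h and summing with bounded coefficients gives an
expansion up to order q + 1 over [trees N q.+1] ([node_expansion]). Starting
from Y_i = y^n + O(h) this yields by induction the expansion of the stages with
the coefficients d_i ([stage_expansion]) and then of the step with the
coefficients u ([step_expansion]). For the exact solution multiplication by h
is replaced by integration, carried out by the mean value inequality, and the
factor |tau| coming from the derivative of h^|tau| produces the coefficients
1 / gamma ([exact_expansion]). Both are used at order p + 1, which the
smoothness C^(p+1) allows.

Subtracting, [local_error] says that the error of one step is, up to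
O(h^(p+1)), the sum of tree_coef(tau) h^|tau| (u(tau) - 1/gamma(tau)) F(tau)
over the trees with |tau| <= p. The order conditions make every term
O(h^(p+1)), so they are sufficient. For the converse the ordered trees that
represent the same unordered tree are collected: u, gamma and |tau| agree on
them, F agrees because second derivatives commute ([derive_comm]), and the
positive weights add up to a nonzero number. The elementary differentials of
distinct unordered trees being independent, the coordinate functionals, which
are bounded, isolate each coefficient h^|tau| (u(tau) - 1/gamma(tau)). *)

(** * Functions of order h^n at 0+ *)

Definition bigOX (R : realType) (W : normedModType R) (n : nat) (g : R -> W) :=
  is_bigO g (fun h => h ^+ n).

Section BigO.
Context {R : realType}.
Implicit Types (W : normedModType R) (m n : nat).

Lemma bigOXP W n (g : R -> W) :
  bigOX n g <-> exists2 C, 0 < C & \forall h \near 0^'+, `|g h| <= C * h ^+ n.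
Proof.
rewrite /bigOX /is_bigO eqO_exP; split=> -[C C0 gC]; exists C => //.
  near=> h; rewrite -[h ^+ n]ger0_norm; first by near: h; exact: gC.
  by apply: exprn_ge0.
near=> h; rewrite ger0_norm; first by near: h; exact: gC.
by apply: exprn_ge0.
Unshelve. all: by end_near. Qed.

Lemma bigOX_bound W n (g : R -> W) C :
  (\forall h \near 0^'+, `|g h| <= C * h ^+ n) -> bigOX n g.
Proof.
move=> gC; apply/bigOXP; exists (Num.max 1 C); first by rewrite lt_max ltr01.
near=> h; apply: (@le_trans _ _ (C * h ^+ n)); first by near: h.
by rewrite ler_wpM2r ?exprn_ge0// le_max lexx orbT.
Unshelve. all: by end_near. Qed.

Lemma bigOX_near W n (f g : R -> W) :
  (\forall h \near 0^'+, f h = g h) -> bigOX n f -> bigOX n g.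
Proof.
move=> fg /bigOXP[C _ fC]; apply: (@bigOX_bound _ _ _ C).
near=> h; have <- : f h = g h by near: h.
by near: h.
Unshelve. all: by end_near. Qed.

Lemma bigOX_dom W W' n (f : R -> W) (g : R -> W') K :
  (\forall h \near 0^'+, `|g h| <= K * `|f h|) -> bigOX n f -> bigOX n g.
Proof.
move=> gf /bigOXP[C C0 fC]; apply: (@bigOX_bound _ _ _ (Num.max 0 K * C)).
near=> h; apply: (@le_trans _ _ (K * `|f h|)); first by near: h.
rewrite -mulrA; apply: (@le_trans _ _ (Num.max 0 K * `|f h|)).
  by rewrite ler_wpM2r// le_max lexx orbT.
by rewrite ler_wpM2l ?le_max ?lexx//; near: h.
Unshelve. all: by end_near. Qed.

Lemma bigOX_le W m n (g : R -> W) : (n <= m)%N -> bigOX m g -> bigOX n g.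
Proof.
move=> nm /bigOXP[C C0 gC]; apply: (@bigOX_bound _ _ _ C).
near=> h; apply: (@le_trans _ _ (C * h ^+ m)); first by near: h.
rewrite ler_wpM2l ?(ltW C0)// ler_wiXn2l//.
by near: h; apply: nbhs_right_le.
Unshelve. all: by end_near. Qed.

Lemma bigOXD W n (f g : R -> W) :
  bigOX n f -> bigOX n g -> bigOX n (fun h => f h + g h).
Proof.
move=> /bigOXP[C C0 fC] /bigOXP[D D0 gD]; apply: (@bigOX_bound _ _ _ (C + D)).
near=> h; rewrite mulrDl (le_trans (ler_normD _ _))// lerD//; by near: h.
Unshelve. all: by end_near. Qed.

Lemma bigOXN W n (f : R -> W) : bigOX n f -> bigOX n (fun h => - f h).
Proof.
by apply: (@bigOX_dom _ _ _ _ _ 1); apply: nearW => h; rewrite normrN mul1r.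
Qed.

Lemma bigOXB W n (f g : R -> W) :
  bigOX n f -> bigOX n g -> bigOX n (fun h => f h - g h).
Proof. by move=> fn gn; apply: bigOXD => //; exact: bigOXN. Qed.

Lemma bigOX0 W n : bigOX n (fun=> 0 : W).
Proof.
by apply: (@bigOX_bound _ _ _ 0); apply: nearW => h; rewrite normr0 mul0r.
Qed.

Lemma bigOX_sum W n (I : Type) (r : seq I) (P : pred I) (F : I -> R -> W) :
  (forall i, P i -> bigOX n (F i)) ->
  bigOX n (fun h => \sum_(i <- r | P i) F i h).
Proof.
move=> Fn; elim: r => [|i r IHr].
  by apply: (bigOX_near _ (@bigOX0 W n)); apply: nearW => h; rewrite big_nil.
case Pi: (P i).
  apply: (bigOX_near _ (bigOXD (Fn i Pi) IHr)).
  by apply: nearW => h; rewrite big_cons Pi.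
by apply: (bigOX_near _ IHr); apply: nearW => h; rewrite big_cons Pi.
Qed.

Lemma bigOXZ W m n (c : R -> R) (g : R -> W) :
  bigOX m c -> bigOX n g -> bigOX (m + n) (fun h => c h *: g h).
Proof.
move=> /bigOXP[C C0 cC] /bigOXP[D D0 gD]; apply: (@bigOX_bound _ _ _ (C * D)).
near=> h; rewrite normrZ exprD mulrACA ler_pM//; by near: h.
Unshelve. all: by end_near. Qed.

Lemma bigOXM m n (c g : R -> R) :
  bigOX m c -> bigOX n g -> bigOX (m + n) (fun h => c h * g h).
Proof. exact: bigOXZ. Qed.

Lemma bigOX_cst W (a : W) : bigOX 0 (fun=> a).
Proof.
by apply: (@bigOX_bound _ _ _ `|a|); apply: nearW => h; rewrite expr0 mulr1.
Qed.

Lemma bigOX_exp n : bigOX n (fun h : R => h ^+ n).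
Proof.
apply: (@bigOX_bound _ _ _ 1); near=> h.
by rewrite mul1r ger0_norm ?exprn_ge0.
Unshelve. all: by end_near. Qed.

Lemma bigOX_cvg0 W n (g : R -> W) (e : R) : 0 < e ->
  bigOX n.+1 g -> \forall h \near 0^'+, `|g h| < e.
Proof.
move=> e0 /(@bigOX_le _ n.+1 1%N _ isT)/bigOXP[C C0 gC]; near=> h.
apply: (@le_lt_trans _ _ (C * h)); first by rewrite -[h in leRHS]expr1; near: h.
rewrite mulrC -ltr_pdivlMr//; near: h; apply: nbhs_right_lt.
by rewrite divr_gt0.
Unshelve. all: by end_near. Qed.

End BigO.

(** * Derivatives along lines and the mean value inequality *)

Section Derivatives.
Context {R : realType} {d : nat}.
Notation V := 'rV[R]_d.
Implicit Types (u v w x : V) (g : V -> V) (vs : seq V).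

Lemma row_norm_le v (K : R) :
  0 <= K -> (forall i, `|v 0 i| <= K) -> `|v| <= K.
Proof.
move=> K0 vK; rewrite /Num.Def.normr/= mx_normrE.
by apply: bigmax_le => // -[i j] _; rewrite /= (ord1 i).
Qed.

Lemma coord_norm_le v i : `|v 0 i| <= `|v|.
Proof.
rewrite [leRHS]/Num.Def.normr/= mx_normrE.
exact: (@le_bigmax _ _ _ _ (fun ij : 'I_1 * 'I_d => `|v ij.1 ij.2|) (0, i)).
Qed.

Lemma is_derive_coord (F : R -> V) (t : R) df i :
  is_derive t 1 F df -> is_derive t 1 (fun s => F s 0 i) (df 0 i).
Proof.
move=> [dF <-]; rewrite (derive_mx dF) mxE; apply: derivableP.
exact: (derivable_mxP _ _ _).1.
Qed.

(** Coordinatewise this is the mean value theorem; the point it provides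
depends on the coordinate, whence an inequality, which is enough because the
norm of a row vector is the maximum of its coordinates. *)
Lemma mean_value_le (F dF : R -> V) (a b K : R) : a <= b ->
  (forall t, t \in `[a, b]%R -> is_derive t 1 F (dF t)) ->
  (forall t, t \in `]a, b[%R -> `|dF t| <= K) ->
  `|F b - F a| <= K * (b - a).
Proof.
rewrite le_eqVlt => /predU1P[<- _ _|ab FdF dFK].
  by rewrite !subrr normr0 mulr0.
have K0 : 0 <= K.
  apply: le_trans (dFK ((a + b) / 2) _); first exact: normr_ge0.
  exact: mid_in_itvoo.
apply: row_norm_le => [|i]; first by rewrite mulr_ge0// subr_ge0 ltW.
pose Fi (s : R) := F s 0 i.
have FidF t : t \in `[a, b]%R -> is_derive t 1 Fi (dF t 0 i).
  by move=> tab; exact/is_derive_coord/FdF.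
have Fic : {within `[a, b], continuous Fi}.
  by apply: derivable_within_continuous => t /FidF[].
have FidF' t : t \in `]a, b[%R -> is_derive t 1 Fi (dF t 0 i).
  by move=> tab; apply: FidF; exact: subset_itv_oo_cc tab.
have [c cab FiE] := MVT ab FidF' Fic.
rewrite !mxE -/(Fi b) -/(Fi a) FiE normrM [X in _ * X]gtr0_norm ?subr_gt0//.
rewrite ler_wpM2r ?subr_ge0 ?(ltW ab)//.
exact: le_trans (coord_norm_le _ _) (dFK _ cab).
Qed.

Lemma is_derive_line g x v (t : R) : differentiable g (x + t *: v) ->
  is_derive t 1 (fun s => g (x + s *: v)) ('D_v g (x + t *: v)).
Proof.
move=> /(@diff_derivable _ _ _ _ _ v) dg.
have E : (fun h : R => h^-1 *: (((fun s => g (x + s *: v)) \o shift t) (h *: 1)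
           - g (x + t *: v))) =
  (fun h : R => h^-1 *: ((g \o shift (x + t *: v)) (h *: v) - g (x + t *: v))).
  apply/funext => h /=; do 3 f_equal.
  have -> : h%:A = h by exact: mulr1.
  by rewrite scalerDl addrCA.
apply: DeriveDef; first by rewrite /derivable E.
by rewrite /derive E.
Qed.

Lemma is_derive_sumZ (U W : normedModType R) (I : Type) (P : pred I) (r : seq I)
    (a : I -> R) (G : I -> U -> W) (dG : I -> W) (x v : U) :
  all P r -> (forall i, P i -> is_derive x v (G i) (dG i)) ->
  is_derive x v (fun y => \sum_(i <- r) a i *: G i y)
    (\sum_(i <- r) a i *: dG i).
Proof.
move=> + GdG; elim: r => [_|i r IHr /= /andP[/GdG dGi /IHr dGr]].
  rewrite big_nil [X in is_derive _ _ X _](_ : _ = cst 0); last first.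
    by apply/funext => y; rewrite big_nil.
  exact: is_derive_cst.
rewrite big_cons [X in is_derive _ _ X _](_ : _ =
  (a i \*: G i) + (fun y => \sum_(j <- r) a j *: G j y)); last first.
  by apply/funext => y; rewrite big_cons.
exact: is_deriveD.
Qed.

Lemma is_derive_powZ (W : normedModType R) n (t : R) (w : W) :
  is_derive t 1 (fun s => s ^+ n.+1 *: w) ((n.+1%:R * t ^+ n) *: w).
Proof.
have dX : differentiable (fun s : R => s ^+ n.+1) t.
  exact/derivable1_diffP/exprn_derivable.
have dF := @differentiableZl _ _ _ _ w _ dX.
apply: DeriveDef; first exact/derivable1_diffP.
rewrite deriveE// diffZl// -deriveE// exp_derive.
by have -> : (n.+1%:R *: t ^+ n)%:A = n.+1%:R * t ^+ n :> R by exact: mulr1.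
Qed.

Lemma is_derive_idZ (W : normedModType R) (t : R) (w : W) :
  is_derive t 1 (fun s => s *: w) w.
Proof. by have := is_derive_powZ 0 t w; rewrite expr0 mulr1 scale1r. Qed.

End Derivatives.

(** * Iterated directional derivatives *)

Fixpoint words (I : Type) (s : seq I) (k : nat) : seq (seq I) :=
  if k is k'.+1 then [seq i :: w | i <- s, w <- words s k'] else [:: [::]].

Definition words_upto (I : Type) (s : seq I) (q : nat) : seq (seq I) :=
  flatten [seq words s k | k <- iota 0 q.+1].

Lemma words_size (I : Type) (s : seq I) k :
  all (fun w => size w == k) (words s k).
Proof.
elim: k => //= k IHk; elim: {2}s => //= i s' IHs'.
by rewrite all_cat IHs' andbT all_map.
Qed.

Section IteratedDerivatives.
Context {R : realType} {d : nat}.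
Notation V := 'rV[R]_d.
Implicit Types (u v x : V) (g : V -> V) (vs : seq V).

Lemma class_CS k g : class_C k.+1 g -> class_C k g.
Proof.
elim: k g => [g [dg _] x|k IHk g [dg Dg]]; last by split=> // v; exact/IHk/Dg.
exact: differentiable_continuous.
Qed.

Lemma class_C_le m k g : (k <= m)%N -> class_C m g -> class_C k g.
Proof.
move=> /subnK <-; elim: (m - k)%N => [//|n IHn]; rewrite addSn => /class_CS.
exact: IHn.
Qed.

Lemma iter_derive_cons g v vs :
  iter_derive g (v :: vs) = 'D_v (iter_derive g vs).
Proof. by []. Qed.

Lemma iter_derive_cat g vs vs' :
  iter_derive g (vs ++ vs') = iter_derive (iter_derive g vs') vs.
Proof. by elim: vs => //= v vs IHvs; rewrite !iter_derive_cons IHvs. Qed.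

Lemma class_C_iter_derive k g vs :
  class_C (k + size vs) g -> class_C k (iter_derive g vs).
Proof.
elim: vs k => [k|v vs IHvs k]; first by rewrite addn0.
by rewrite /= addnS -addSn => /IHvs[_ /(_ v)].
Qed.

Lemma derive_sumZ_dir (I : Type) (r : seq I) (c : I -> R) (u : I -> V) g x :
  differentiable g x ->
  'D_(\sum_(i <- r) c i *: u i) g x = \sum_(i <- r) c i *: 'D_(u i) g x.
Proof.
move=> dg; rewrite deriveE// linear_sum; apply: eq_bigr => i _.
by rewrite linearZ deriveE.
Qed.

Lemma iter_derive_sumZ (I : Type) (r : seq I) (a : I -> R)
    (G : I -> V -> V) vs :
  (forall i, class_C (size vs) (G i)) ->
  iter_derive (fun x => \sum_(i <- r) a i *: G i x) vs =
  fun x => \sum_(i <- r) a i *: iter_derive (G i) vs x.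
Proof.
elim: vs => [//|v vs IHvs] CG.
rewrite iter_derive_cons IHvs => [|i]; last exact/class_CS/CG.
apply/funext => x; apply: derive_val.
apply: (is_derive_sumZ (P := xpredT)) => [|i _]; first exact: all_predT.
have [dG _] : class_C 1 (iter_derive (G i) vs) by exact/class_C_iter_derive/CG.
exact/derivableP/diff_derivable.
Qed.

(** The head of the list of directions is the outermost derivative, so the
expansion proceeds by one differentiation at a time: the new direction is
expanded by linearity of the differential, the old derivatives by the induction
hypothesis as functions. *)
Lemma iter_derive_words (I : Type) (r : seq I) (c : I -> R) (u : I -> V) g k :
  class_C k g ->
  iter_derive g (nseq k (\sum_(i <- r) c i *: u i)) =
  fun x => \sum_(w <- words r k)
    (\prod_(i <- w) c i) *: iter_derive g (map u w) x.
Proof.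
elim: k => [_|k IHk Cg].
  by apply/funext => x; rewrite big_seq1 big_nil scale1r.
set S := \sum_(i <- r) _ in IHk *.
have dG vs : size vs = k -> forall x, differentiable (iter_derive g vs) x.
  by move=> sz; have [] : class_C 1 (iter_derive g vs)
    by apply: class_C_iter_derive; rewrite sz.
rewrite -[nseq _ _]/(S :: nseq k S) iter_derive_cons.
rewrite -[words _ _]/[seq i :: w | i <- r, w <- words r k].
apply/funext => x.
rewrite derive_sumZ_dir; last by apply: dG; rewrite size_nseq.
rewrite big_allpairs_dep; apply: eq_bigr => i _.
rewrite IHk; last exact: class_CS.
have D : is_derive x (u i)
    (fun y => \sum_(w <- words r k)
       \prod_(j <- w) c j *: iter_derive g (map u w) y)
    (\sum_(w <- words r k)
       \prod_(j <- w) c j *: 'D_(u i) (iter_derive g (map u w)) x).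
  apply: (is_derive_sumZ _ (words_size r k)) => w /eqP sw.
  by apply/derivableP/diff_derivable/dG; rewrite size_map.
rewrite (@derive_val _ _ _ _ _ _ _ D) scaler_sumr; apply: eq_bigr => w _.
by rewrite big_cons scalerA.
Qed.

(** A scalar multiple is a sum over the one-letter alphabet [unit]. *)
Lemma iter_derive_nseqZ g k v (t : R) : class_C k g ->
  iter_derive g (nseq k (t *: v)) =
  fun x => t ^+ k *: iter_derive g (nseq k v) x.
Proof.
move=> Cg; have := @iter_derive_words unit [:: tt] (fun=> t) (fun=> v) g k Cg.
rewrite big_seq1 => ->; apply/funext => x.
have -> : words [:: tt] k = [:: nseq k tt].
  by elim: (k) => //= n ->.
by rewrite big_seq1 big_const_seq count_predT size_nseq iter_mulr_1 map_nseq.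
Qed.

Lemma derive_coord_sum g x v : differentiable g x ->
  'D_v g x = \sum_(i < d) v 0 i *: 'D_(delta_mx 0 i) g x.
Proof.
by move=> dg; rewrite {1}(row_sum_delta v) derive_sumZ_dir.
Qed.

(** The Taylor polynomial of degree m - 1, with a remainder of order m. *)
Definition taylor g m x v : V :=
  \sum_(k < m) k`!%:R^-1 *: iter_derive g (nseq k v) x.

Lemma taylor_segment g m x v (t : R) : class_C m g ->
  taylor g m x (t *: v) =
  \sum_(k < m) (t ^+ k / k`!%:R) *: iter_derive g (nseq k v) x.
Proof.
move=> Cg; apply: eq_bigr => k _; rewrite iter_derive_nseqZ ?scalerA 1?mulrC//.
exact: class_C_le (ltnW (ltn_ord k)) Cg.
Qed.

(** Differentiating along the segment turns the Taylor polynomial of g into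
that of the derivative of g in the direction v, which drives the induction in
[taylor_remainder]. *)
Lemma is_derive_taylor g m x v (t : R) : class_C m.+1 g ->
  is_derive t 1 (fun s => taylor g m.+1 x (s *: v))
    (taylor ('D_v g) m x (t *: v)).
Proof.
move=> Cg.
rewrite [X in is_derive _ _ X _](_ : _ = cst (g x) + (fun s =>
  \sum_(k < m) k.+1`!%:R^-1 *:
    (s ^+ k.+1 *: iter_derive g (nseq k.+1 v) x))); last first.
  apply/funext => s; rewrite taylor_segment// big_ord_recl/=.
  rewrite expr0 fact0 divr1 scale1r; congr (_ + _).
  by apply: eq_bigr => k _; rewrite scalerA mulrC.
rewrite taylor_segment; last exact: Cg.2.
rewrite -[X in is_derive _ _ _ X]add0r; apply: is_deriveD.
have -> : \sum_(k < m) (t ^+ k / k`!%:R) *: iter_derive ('D_v g) (nseq k v) x =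
   \sum_(k < m) k.+1`!%:R^-1 *:
     ((k.+1%:R * t ^+ k) *: iter_derive g (nseq k.+1 v) x).
  apply: eq_bigr => k _; rewrite scalerA; congr (_ *: _).
    by rewrite factS natrM invfM mulrACA mulVf ?mul1r 1?mulrC.
  by rewrite -(addn1 k) nseqD iter_derive_cat.
apply: (is_derive_sumZ (P := xpredT)) => [|i _]; first exact: all_predT.
exact: is_derive_powZ.
Qed.

End IteratedDerivatives.

(** * Taylor's formula and the symmetry of second derivatives *)

Section TaylorSchwarz.
Context {R : realType} {d : nat}.
Notation V := 'rV[R]_d.
Implicit Types (u v x : V) (g : V -> V) (vs : seq V).

Lemma taylor_derive_coord g m x v w : class_C m.+1 g ->
  taylor ('D_v g) m x w =
  \sum_(i < d) v 0 i *: taylor ('D_(delta_mx 0 i) g) m x w.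
Proof.
move=> [dg Dg]; rewrite /taylor.
have -> : 'D_v g = fun y => \sum_(i < d) v 0 i *: 'D_(delta_mx 0 i) g y.
  by apply/funext => y; exact: derive_coord_sum.
under eq_bigr => k _.
  rewrite iter_derive_sumZ; last first.
    move=> i; rewrite size_nseq; exact: class_C_le (ltnW (ltn_ord k)) (Dg _).
  rewrite scaler_sumr; over.
rewrite exchange_big; apply: eq_bigr => i _; rewrite scaler_sumr.
by apply: eq_bigr => k _; rewrite !scalerA mulrC.
Qed.

(** By induction on m: along the segment from x to x + v the remainder has as
derivative the remainder of order m of 'D_v g, which is a combination with
coefficients v_i of the remainders of the partial derivatives of g; the factor
v_i gains one power of the norm of v. Working with the fixed finite family of
partial derivatives makes the constant independent of v. *)
Lemma taylor_remainder g m x : class_C m g ->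
  exists C, \forall v \near (0 : V),
    `|g (x + v) - taylor g m x v| <= C * `|v| ^+ m.
Proof.
elim: m g => [g gc|m IHm g Cg].
  exists (`|g x| + 1).
  have gx : (fun v => g (x + v)) @ (0 : V) --> g x.
    have xc : (fun v => x + v) @ (0 : V) --> x.
      rewrite -[X in _ --> X]addr0.
      exact: (@cvgD _ _ _ _ _ (fun=> x) id x 0 (cvg_cst x)
        (@cvg_id _ (nbhs (0 : V)))).
    exact: (cvg_comp _ _ xc (gc x)).
  move/cvgrPdist_le : gx => /(_ 1 ltr01); apply: filterS => v gxv.
  rewrite /taylor big_ord0 subr0 expr0 mulr1.
  rewrite -[g (x + v)](subrK (g x)) addrC (le_trans (ler_normD _ _))// lerD2l.
  by rewrite distrC.
have [dg Dg] := Cg.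
have /choice[C HC] : forall i : 'I_d, exists C, \forall v \near (0 : V),
    `|'D_(delta_mx 0 i) g (x + v) - taylor ('D_(delta_mx 0 i) g) m x v|
      <= C * `|v| ^+ m by move=> i; apply: IHm; exact: Dg.
have {}HC : \forall v \near (0 : V), forall i : 'I_d,
    `|'D_(delta_mx 0 i) g (x + v) - taylor ('D_(delta_mx 0 i) g) m x v|
      <= C i * `|v| ^+ m.
  exact: (@filter_forall _ _ _ (nbhs (0 : V)) _ HC).
have /nbhs_norm0P[e /= e0 He] := HC.
(* C i need not be positive. *)
exists (\sum_(i < d) `|C i|); apply/nbhs_norm0P; exists e => //= v ve.
pose F (t : R) : V := g (x + t *: v) - taylor g m.+1 x (t *: v).
pose dF (t : R) : V := 'D_v g (x + t *: v) - taylor ('D_v g) m x (t *: v).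
have F0 : F 0 = 0.
  rewrite /F scale0r addr0 /taylor big_ord_recl big1 => [|k _]; last first.
    by rewrite -[nseq _ _]/(0 :: nseq k 0) iter_derive_cons derive0 scaler0.
  by rewrite fact0 invr1 scale1r addr0 subrr.
have := @mean_value_le R d F dF 0 1 ((\sum_(i < d) `|C i|) * `|v| ^+ m.+1)
  ler01.
rewrite F0 !subr0 mulr1 /F scale1r; apply => t tI.
  apply: is_deriveB; first exact: is_derive_line.
  exact: is_derive_taylor.
rewrite /dF taylor_derive_coord// derive_coord_sum// -sumrB.
rewrite (le_trans (ler_norm_sum _ _ _))// mulr_suml; apply: ler_sum => i _.
have /andP[t0 t1] : (0 <= t) && (t <= 1).
  by move: tI; rewrite in_itv/= => /andP[/ltW-> /ltW->].
have tv : `|t *: v| <= `|v| by rewrite normrZ ger0_norm// ler_piMl.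
have Hi := He (t *: v) (le_lt_trans tv ve) i.
rewrite -scalerBr normrZ exprS mulrCA ler_pM ?coord_norm_le//.
rewrite (le_trans Hi)// (@le_trans _ _ (`|C i| * `|t *: v| ^+ m))//.
  by rewrite ler_wpM2r ?exprn_ge0// ler_norm.
by rewrite ler_wpM2l// lerXn2r ?nnegrE.
Unshelve. all: by end_near. Qed.

(** The second difference approximates t^2 D_v D_u g(x): apply the mean value
inequality first in the direction u, then in the direction v, the continuity of
the mixed derivative at x controlling the error. *)
Lemma second_difference_le g u v x (e : R) : class_C 2 g -> 0 < e ->
  \forall t \near (0 : R)^'+,
    `|g (x + t *: u + t *: v) - g (x + t *: u) - g (x + t *: v) + g x
      - (t ^+ 2) *: 'D_v ('D_u g) x| <= e * t ^+ 2.
Proof.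
move=> Cg e0.
have [dg Dg] := Cg; have [dug /(_ v) cvug] := Dg u.
have /cvgrPdist_le/(_ e e0)/nbhs_normP[r /= r0 Hr] := cvug x.
near=> t.
have t0 : 0 < t by [].
have tr : t * (`|u| + `|v|) < r.
  apply: (@le_lt_trans _ _ (t * (`|u| + `|v| + 1))).
    by rewrite ler_wpM2l ?(ltW t0)// lerDl.
  rewrite -ltr_pdivlMr ?ltr_wpDl// ?addr_ge0//; near: t; apply: nbhs_right_lt.
  by rewrite divr_gt0// ltr_wpDl// addr_ge0.
set B := 'D_v ('D_u g) x.
have Hs s s' : s \in `[0, t]%R -> s' \in `[0, t]%R ->
    `|'D_v ('D_u g) (x + s *: u + s' *: v) - B| <= e.
  rewrite !in_itv/= => /andP[s0 st] /andP[s'0 s't]; rewrite distrC; apply: Hr.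
  rewrite /= -addrA opprD addNKr normrN (le_lt_trans _ tr)//.
  rewrite (le_trans (ler_normD _ _))// mulrDr !normrZ !ger0_norm//.
  by rewrite lerD// ler_wpM2r.
pose F (s : R) : V := g (x + t *: v + s *: u) - g (x + s *: u) - s *: (t *: B).
pose dF (s : R) : V :=
  'D_u g (x + t *: v + s *: u) - 'D_u g (x + s *: u) - t *: B.
have FE : F t - F 0 = g (x + t *: u + t *: v) - g (x + t *: u)
    - g (x + t *: v) + g x - t ^+ 2 *: B.
  rewrite /F !scale0r !addr0 subr0 scalerA -expr2 (addrAC x).
  rewrite opprB !addrA -!addrA; do 2 congr (_ + _).
  by rewrite addrC -!addrA addrCA.
rewrite -FE expr2 mulrA -[X in _ * X]subr0.
apply: (@mean_value_le R d F dF 0 t (e * t) (ltW t0)) => s sI.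
  apply: is_deriveB; first by apply: is_deriveB; exact: is_derive_line.
  exact: is_derive_idZ.
pose G (s' : R) : V := 'D_u g (x + s *: u + s' *: v) - s' *: B.
pose dG (s' : R) : V := 'D_v ('D_u g) (x + s *: u + s' *: v) - B.
have -> : dF s = G t - G 0.
  rewrite /dF /G !scale0r !addr0 subr0 (addrAC x).
  by rewrite [RHS]addrAC.
rewrite -[X in _ * X]subr0.
apply: (@mean_value_le R d G dG 0 t e (ltW t0)) => s' s'I.
  apply: is_deriveB; first exact: is_derive_line.
  exact: is_derive_idZ.
by apply: Hs; exact: subset_itv_oo_cc.
Unshelve. all: by end_near. Qed.

End TaylorSchwarz.

(** * Substituting an expansion into a smooth map *)

Section Composition.
Context {R : realType} {d : nat}.
Notation V := 'rV[R]_d.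
Implicit Types (u v x : V) (g : V -> V) (vs : seq V).

(** The second difference of [second_difference_le] is symmetric in u and v. *)
Lemma derive_comm g u v x : class_C 2 g -> 'D_v ('D_u g) x = 'D_u ('D_v g) x.
Proof.
move=> Cg; apply/eqP; rewrite -subr_eq0 -normr_le0.
apply/ler_addgt0Pl => e e0; rewrite addr0.
have e2 : 0 < e / 2 by rewrite divr_gt0.
have Huv := second_difference_le u v x Cg e2.
have Hvu := second_difference_le v u x Cg e2.
have [t [[Huvt Hvut] t0]] :=
  filter_ex (filterI (filterI Huv Hvu) (nbhs_right_gt (0 : R))).
have t2 : 0 < t ^+ 2 by rewrite exprn_gt0.
have distE (a : R) (D P Q : V) :
    a *: (P - Q) = (D - a *: Q) - (D - a *: P).
  by rewrite scalerBr opprB [RHS]addrC addrA subrK.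
rewrite -(ler_pM2r t2) -[X in _ * X <= _](gtr0_norm t2) mulrC -normrZ.
rewrite (distE _ (g (x + t *: u + t *: v) - g (x + t *: u)
  - g (x + t *: v) + g x)).
apply: (le_trans (ler_normB _ _)); rewrite [e in e * _]splitr mulrDl.
apply: lerD; last exact: Huvt.
rewrite (addrAC x) (addrAC (g _)); exact: Hvut.
Qed.

Lemma iter_derive_swap g vs1 vs2 u v :
  class_C (size vs1 + (size vs2).+2) g ->
  iter_derive g (vs1 ++ u :: v :: vs2) = iter_derive g (vs1 ++ v :: u :: vs2).
Proof.
move=> Cg; rewrite !iter_derive_cat !iter_derive_cons.
have C2 : class_C 2 (iter_derive g vs2).
  by apply: class_C_iter_derive; apply: class_C_le Cg; exact: leq_addl.
have E : 'D_u ('D_v (iter_derive g vs2)) = 'D_v ('D_u (iter_derive g vs2)).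
  by apply/funext => x; exact: derive_comm C2.
exact (congr1 (fun g' => iter_derive g' vs1) E).
Qed.

Lemma lipschitzP g : lipschitz g -> exists2 L, 0 <= L &
  forall u v, `|g u - g v| <= L * `|u - v|.
Proof.
move=> [M [Mr gM]]; exists (Num.max 0 (M + 1)); first by rewrite le_max lexx.
move=> u v; have := gM (Num.max 0 (M + 1)) _ (u, v) (conj I I); apply.
by rewrite lt_max ltrDl ltr01 orbT.
Qed.

Lemma bigOX_lipschitz_comp n g (Y Z : R -> V) : lipschitz g ->
  bigOX n (fun h => Y h - Z h) -> bigOX n (fun h => g (Y h) - g (Z h)).
Proof.
move=> /lipschitzP[L _ gL]; apply: (@bigOX_dom _ _ _ _ _ _ L).
exact: nearW.
Qed.

(** The Lipschitz condition replaces Y by x + S up to the admitted error, S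
being the given sum, so that Taylor's formula is expanded exactly, without any
perturbation term in the multilinear part. *)
Lemma comp_expansion (I : Type) (s : seq I) (c : R -> I -> R) (u : I -> V) g q x
    (Y : R -> V) :
  class_C q.+1 g -> lipschitz g ->
  (forall i, bigOX 1 (fun h => c h i)) ->
  bigOX q.+1 (fun h => Y h - x - \sum_(i <- s) c h i *: u i) ->
  bigOX q.+1 (fun h => g (Y h) -
    \sum_(w <- words_upto s q)
      ((size w)`!%:R^-1 * \prod_(i <- w) c h i) *: iter_derive g (map u w) x).
Proof.
move=> Cg Lg c1 YO.
pose S h := \sum_(i <- s) c h i *: u i.
have S1 : bigOX 1 S.
  by apply: bigOX_sum => i _; exact: (@bigOXZ _ _ 1 0 _ _ (c1 i) (bigOX_cst _)).
have gYS : bigOX q.+1 (fun h => g (Y h) - g (x + S h)).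
  apply: bigOX_lipschitz_comp Lg _; apply: (bigOX_near _ YO).
  by apply: nearW => h; rewrite opprD addrA.
have gST : bigOX q.+1 (fun h => g (x + S h) - taylor g q.+1 x (S h)).
  have [C /nbhs_norm0P[e /= e0 He]] := taylor_remainder x Cg.
  have /bigOXP[D D0 SD] := S1.
  apply: (@bigOX_bound _ _ _ _ (`|C| * D ^+ q.+1)); near=> h.
  have Se : `|S h| < e by near: h; exact: bigOX_cvg0 S1.
  rewrite (le_trans (He _ Se))// (@le_trans _ _ (`|C| * `|S h| ^+ q.+1))//.
    by rewrite ler_wpM2r ?exprn_ge0// ler_norm.
  rewrite -mulrA ler_wpM2l// -exprMn lerXn2r ?nnegrE//.
    by rewrite mulr_ge0// ltW.
  by rewrite -[h]expr1; near: h.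
apply: (bigOX_near _ (bigOXD gYS gST)); apply: nearW => h.
rewrite addrA subrK; congr (_ - _).
rewrite /words_upto big_flatten big_map -[iota 0 q.+1]/(index_iota 0 q.+1).
rewrite big_mkord.
apply: eq_bigr => k _; rewrite iter_derive_words; last first.
  exact: class_C_le (ltnW (ltn_ord k)) Cg.
rewrite scaler_sumr; elim: (words s k) (words_size s k) => [|w ws IHws].
  by rewrite !big_nil.
by rewrite !big_cons /= => /andP[/eqP-> /IHws ->]; rewrite scalerA.
Unshelve. all: by end_near. Qed.

End Composition.

(** * Expansions over colored trees *)

(** The automatically generated principle gives no hypothesis on the children,
which sit inside a list. *)
Lemma ctree_nested_ind (N : nat) (P : ctree N -> Prop) :
  (forall mu ts, foldr (fun t Q => P t /\ Q) True ts -> P (CNode mu ts)) ->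
  forall t, P t.
Proof.
move=> PN; fix IH 1 => -[mu ts]; apply: PN.
by elim: ts => //= t ts IHts; split.
Qed.

(** Every tree of size at most q occurs ([mem_trees]), and some larger ones too:
the truncation is on the number of children and the depth. Larger trees carry
higher powers of h, and with this choice the recursion follows exactly the
Taylor expansion of order q at the root. *)
Fixpoint trees (N q : nat) : seq (ctree N) :=
  if q is q'.+1 then
    [seq CNode mu ts | mu <- index_enum 'I_N, ts <- words_upto (trees N q') q']
  else [::].

Lemma treesS (N q : nat) : trees N q.+1 =
  [seq CNode mu ts | mu <- index_enum 'I_N, ts <- words_upto (trees N q) q].
Proof. by []. Qed.

(* Classical decidable equality, for membership in lists of trees. *)
HB.instance Definition _ (N : nat) := gen_eqMixin (ctree N).

Lemma mem_words (I : eqType) (s w : seq I) k :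
  (w \in words s k) = (size w == k) && all [in s] w.
Proof.
elim: k w => [w|k IHk w /=]; first by rewrite inE; case: w.
apply/allpairsP/andP => [[[i w'] /= [si]]|[]].
  by rewrite IHk => /andP[/eqP <- sw'] ->; rewrite /= si sw' eqxx.
case: w => //= i w; rewrite eqSS => wk /andP[si sw]; exists (i, w); split=> //=.
by rewrite IHk wk.
Qed.

Lemma mem_trees (N q : nat) (t : ctree N) :
  (tree_size t <= q)%N -> t \in trees N q.
Proof.
elim: q t => [[mu ts]//|q IHq [mu ts]].
rewrite treesS [tree_size _]/= ltnS => tsq.
apply: allpairs_f; first exact: mem_index_enum.
have size_le : (size ts <= sumn (map (@tree_size N) ts))%N.
  by elim: ts {tsq} => //= -[nu us] ts IHts; rewrite -add1n leq_add.
have all_le : all (fun t => tree_size t <= sumn (map (@tree_size N) ts))%N ts.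
  elim: ts {tsq size_le} => //= t ts IHts; rewrite leq_addr/=.
  by apply: sub_all IHts => t' /leq_trans; apply; exact: leq_addl.
apply/flattenP; exists (words (trees N q) (size ts)).
  by apply: map_f; rewrite mem_iota/= add0n ltnS (leq_trans size_le).
rewrite mem_words eqxx/=; apply: sub_all all_le => t t_le.
exact/IHq/(leq_trans t_le).
Qed.

Section Expansion.
Context {R : realType} {d N : nat}.
Notation V := 'rV[R]_d.

(** The product over all nodes of the inverse factorial of the number of
children. Its sum over the ordered representatives of an unordered tree is the
usual 1 / sigma. *)
Fixpoint tree_coef (t : ctree N) : R :=
  let: CNode _ ts := t in
  (size ts)`!%:R^-1 * \prod_(c <- [seq tree_coef t' | t' <- ts]) c.

Lemma tree_coef_gt0 t : 0 < tree_coef t.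
Proof.
elim/ctree_nested_ind: t => mu ts /= IHts.
rewrite mulr_gt0 ?invr_gt0 ?ltr0n ?fact_gt0// big_map.
elim: ts IHts => [|t ts IH /= [t0 /IH ?]]; first by rewrite big_nil.
by rewrite big_cons mulr_gt0.
Qed.

(** How the coefficients c of the arguments of the f^[mu] produce those of
their combination with weights om: the recursion that defines u and d_i. *)
Definition node_weight (s : nat) (om : 'I_N -> 'I_s -> R)
    (c : 'I_s -> ctree N -> R) (t : ctree N) : R :=
  let: CNode mu ts := t in \sum_(j < s) om mu j * \prod_(t' <- ts) c j t'.

Variables (f : 'I_N -> V -> V) (x : V).

Definition bseries (q : nat) (c : ctree N -> R) (h : R) : V :=
  \sum_(t <- trees N q)
    (h ^+ tree_size t * tree_coef t * c t) *: elem_diff f t x.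

(** [comp_expansion] for the letters t with coefficients
h^|t| tree_coef(t) c(t), which are O(h) because |t| >= 1; regrouping gives the
weight of the tree with children ts. *)
Lemma bseries_comp q mu (c : R -> ctree N -> R) (Y : R -> V) :
  class_C q.+1 (f mu) -> lipschitz (f mu) ->
  (forall t, bigOX 0 (fun h => c h t)) ->
  bigOX q.+1 (fun h => Y h - x - bseries q (c h) h) ->
  bigOX q.+1 (fun h => f mu (Y h) - \sum_(ts <- words_upto (trees N q) q)
    (h ^+ sumn (map (@tree_size N) ts) * tree_coef (CNode mu ts)
       * \prod_(t <- ts) c h t) *: elem_diff f (CNode mu ts) x).
Proof.
move=> fC fL c0 YO.
pose c' (h : R) (t : ctree N) := h ^+ tree_size t * tree_coef t * c h t.
have c'1 t : bigOX 1 (fun h => c' h t).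
  apply: (@bigOXM _ 1 0 _ _ _ (c0 t)).
  apply: (@bigOXM _ 1 0 _ (fun=> tree_coef t) _ (bigOX_cst _)).
  by apply: bigOX_le (bigOX_exp _); case: t.
apply: (bigOX_near _ (comp_expansion fC fL c'1 YO)).
apply: nearW => h; congr (_ - _); apply: eq_bigr => ts _; congr (_ *: _).
rewrite /= -!mulrA mulrCA; congr (_ * _); rewrite /c' big_map.
elim: ts => [|t ts IHts]; first by rewrite !big_nil !mulr1.
rewrite !big_cons IHts/= exprD; ring.
Qed.

(** The factor h accounts for the new root, whence the gain of one order. *)
Lemma node_expansion q (s : nat) (om : R -> 'I_N -> 'I_s -> R)
    (c : R -> 'I_s -> ctree N -> R) (Y : R -> 'I_s -> V) :
  (forall mu, class_C q.+1 (f mu)) -> (forall mu, lipschitz (f mu)) ->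
  (forall mu j, bigOX 0 (fun h => om h mu j)) ->
  (forall j t, bigOX 0 (fun h => c h j t)) ->
  (forall j, bigOX q.+1 (fun h => Y h j - x - bseries q (c h j) h)) ->
  bigOX q.+2 (fun h => h *: \sum_(j < s) \sum_(nu < N) om h nu j *: f nu (Y h j)
    - bseries q.+1 (node_weight (om h) (c h)) h).
Proof.
move=> fC fL om0 c0 YO.
pose E h j nu := f nu (Y h j) - \sum_(ts <- words_upto (trees N q) q)
    (h ^+ sumn (map (@tree_size N) ts) * tree_coef (CNode nu ts)
       * \prod_(t <- ts) c h j t) *: elem_diff f (CNode nu ts) x.
have EO : bigOX q.+2
    (fun h => h *: \sum_(j < s) \sum_(nu < N) om h nu j *: E h j nu).
  apply: (@bigOXZ _ _ 1 q.+1 (fun h => h)); first exact: bigOX_exp 1%N.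
  apply: bigOX_sum => j _; apply: bigOX_sum => nu _.
  apply: (@bigOXZ _ _ 0 q.+1 _ _ (om0 nu j)).
  exact: bseries_comp (fC nu) (fL nu) (c0 j) (YO j).
apply: (bigOX_near _ EO); apply: nearW => h.
rewrite /E; under eq_bigr do under eq_bigr do rewrite scalerBr.
under eq_bigr do rewrite sumrB; rewrite sumrB scalerBr; congr (_ - _).
rewrite /bseries treesS big_allpairs_dep exchange_big/= scaler_sumr.
apply: eq_bigr => nu _.
under eq_bigr do rewrite scaler_sumr.
rewrite exchange_big/= scaler_sumr; apply: eq_bigr => ts _.
under eq_bigr do rewrite scalerA.
rewrite -scaler_suml scalerA; congr (_ *: _).
rewrite exprS -!mulrA; congr (_ * _); rewrite !mulr_sumr.
by apply: eq_bigr => j _; ring.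
Qed.

End Expansion.

(** * Expansion of the stages and of the step *)

Section Numerical.
Context {R : realType} {d N s : nat}.
Notation V := 'rV[R]_d.

(** Both u and d_i have this form, with om given by b or by the i-th row
of A. *)
Definition weighted_sum (A : 'I_N -> 'M[R]_s) (om : 'I_N -> 'I_s -> R)
    (t : ctree N) : R :=
  \sum_(nu < N) \sum_(j < s) om nu j * stage_weight A t nu j.

Lemma weighted_sum_node A om t : weighted_sum A om t =
  node_weight om (fun j => weighted_sum A (fun nu => A nu j)) t.
Proof.
case: t => mu ts; rewrite /weighted_sum/= (bigD1 mu)//= [X in _ + X]big1.
  rewrite addr0; apply: eq_bigr => j _; rewrite eqxx mul1r big_map.
  by [].
move=> nu /negbTE numu; rewrite numu; apply: big1 => j _.
by rewrite mul0r mulr0.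
Qed.

Lemma bigOX_weighted_sum (A : R -> 'I_N -> 'M[R]_s)
    (om : R -> 'I_N -> 'I_s -> R) t :
  (forall nu i j, bigOX 0 (fun h => A h nu i j)) ->
  (forall nu j, bigOX 0 (fun h => om h nu j)) ->
  bigOX 0 (fun h => weighted_sum (A h) (om h) t).
Proof.
move=> A0; elim/ctree_nested_ind: t om => mu ts IHts om om0.
under eq_fun do rewrite weighted_sum_node.
apply: bigOX_sum => j _; apply: (@bigOXM _ 0 0 _ _ (om0 mu j)).
elim: ts IHts => [_|t ts IH /= [tO /IH tsO]].
  apply: (bigOX_near _ (bigOX_cst (1 : R))); apply: nearW => h.
  by rewrite big_nil.
apply: (bigOX_near _ (@bigOXM _ 0 0 _ _ (tO _ (fun nu => A0 nu j)) tsO)).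
by apply: nearW => h; rewrite big_cons.
Qed.

Variables (f : 'I_N -> V -> V) (x : V).
Hypothesis fL : forall nu, lipschitz (f nu).
Variables (A : R -> 'I_N -> 'M[R]_s) (Y : R -> 'I_s -> V).
Hypothesis A0 : forall nu i j, bigOX 0 (fun h => A h nu i j).
Hypothesis YE : \forall h \near 0^'+, forall i,
  Y h i = x + h *: \sum_(j < s) \sum_(nu < N) A h nu i j *: f nu (Y h j).

(** With e the sum over i of |Y_i - x|, boundedness of A and the Lipschitz
condition give e <= h (P + Q e), where P and Q do not depend on h; hence
e <= 2 h P as soon as h Q <= 1/2. *)
Lemma stage_near i : bigOX 1 (fun h => Y h i - x).
Proof.
have /choice[L LP] : forall nu, exists L, 0 <= L /\
    forall u v, `|f nu u - f nu v| <= L * `|u - v|.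
  by move=> nu; have [L L0 fLip] := lipschitzP (fL nu); exists L.
pose I := ('I_N * 'I_s * 'I_s)%type.
have /choice[C CP] : forall k : I, exists C, 0 < C /\
    \forall h \near 0^'+, `|A h k.1.1 k.1.2 k.2| <= C.
  move=> k; have /bigOXP[C C0 AC] := A0 k.1.1 k.1.2 k.2; exists C; split=> //.
  by apply: filterS AC => h; rewrite expr0 mulr1.
have AC : \forall h \near 0^'+, forall k : I, `|A h k.1.1 k.1.2 k.2| <= C k.
  by apply: filter_forall => k; have [] := CP k.
pose P := \sum_(i < s) \sum_(j < s) \sum_(nu < N) C (nu, i, j) * `|f nu x|.
pose Q := \sum_(i < s) \sum_(j < s) \sum_(nu < N) C (nu, i, j) * L nu.
have Q0 : 0 <= Q.
  apply: sumr_ge0 => i' _; apply: sumr_ge0 => j _; apply: sumr_ge0 => nu _.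
  by rewrite mulr_ge0 ?(LP nu).1// ltW// (CP _).1.
apply: (@bigOX_bound _ _ _ _ (2 * P)); near=> h.
have h0 : 0 < h by [].
pose e := \sum_(i < s) `|Y h i - x|.
have e_ge j : `|Y h j - x| <= e.
  by rewrite /e (bigD1 j)//= lerDl sumr_ge0.
have e_le : e <= h * (P + Q * e).
  have ACh : forall k : I, `|A h k.1.1 k.1.2 k.2| <= C k by near: h.
  have Yh : forall i, Y h i =
      x + h *: \sum_(j < s) \sum_(nu < N) A h nu i j *: f nu (Y h j).
    by near: h.
  rewrite mulr_suml -big_split mulr_sumr; apply: ler_sum => i' _.
  rewrite [in leLHS]Yh addrAC subrr add0r normrZ gtr0_norm//.
  rewrite ler_wpM2l ?(ltW h0)// (le_trans (ler_norm_sum _ _ _))//.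
  rewrite mulr_suml -big_split; apply: ler_sum => j _ /=.
  rewrite (le_trans (ler_norm_sum _ _ _))// mulr_suml -big_split.
  apply: ler_sum => nu _ /=; rewrite normrZ -mulrA -mulrDr.
  rewrite ler_pM ?(ACh (nu, i', j))//.
  rewrite -[f nu (Y h j)](subrK (f nu x)) addrC.
  rewrite (le_trans (ler_normD _ _))// lerD2l.
  by rewrite (le_trans ((LP nu).2 _ _))// ler_wpM2l ?(LP nu).1.
have hQ : h * Q <= 2^-1.
  have : h < 2^-1 / (Q + 1).
    by near: h; apply: nbhs_right_lt; rewrite divr_gt0 ?invr_gt0// ltr_wpDl.
  rewrite ltr_pdivlMr ?ltr_wpDl// => /ltW; apply: le_trans.
  by rewrite ler_wpM2l ?(ltW h0)// lerDl.
rewrite expr1 (le_trans (e_ge i))//.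
have : e <= h * P + e / 2.
  rewrite (le_trans e_le)// mulrDr lerD2l mulrA [e / 2]mulrC.
  by rewrite ler_wpM2r// /e sumr_ge0.
lra.
Unshelve. all: by end_near. Qed.

Lemma stage_expansion q i : (forall nu, class_C q (f nu)) ->
  bigOX q.+1 (fun h => Y h i - x -
    bseries f x q (weighted_sum (A h) (fun nu => A h nu i)) h).
Proof.
elim: q i => [i _|q IHq i fC].
  apply: (bigOX_near _ (stage_near i)); apply: nearW => h.
  by rewrite /bseries big_nil subr0.
have fC' nu : class_C q (f nu) by exact/class_CS/fC.
have := node_expansion fC fL (fun mu j => A0 mu i j)
  (fun j t => bigOX_weighted_sum t A0 (fun nu => A0 nu j)) (fun j => IHq j fC').
apply: bigOX_near; near=> h.
have -> : Y h i =
    x + h *: \sum_(j < s) \sum_(nu < N) A h nu i j *: f nu (Y h j).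
  by move: i; near: h.
rewrite [x + _]addrC addrK; congr (_ - _); apply: eq_bigr => t _.
by rewrite -weighted_sum_node.
Unshelve. all: by end_near. Qed.

Lemma step_expansion p (b : R -> 'I_N -> 'rV[R]_s) :
  (forall nu, class_C p.+1 (f nu)) ->
  (forall nu j, bigOX 0 (fun h => b h nu 0 j)) ->
  bigOX p.+2 (fun h =>
     h *: \sum_(j < s) \sum_(nu < N) b h nu 0 j *: f nu (Y h j)
     - bseries f x p.+1 (step_weight (A h) (b h)) h).
Proof.
move=> fC b0.
have fC' nu : class_C p (f nu) by exact/class_CS/fC.
have := node_expansion fC fL (fun mu j => b0 mu j)
  (fun j t => bigOX_weighted_sum t A0 (fun nu => A0 nu j))
  (fun j => stage_expansion j fC').
apply: bigOX_near; apply: nearW => h.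
congr (_ - _); apply: eq_bigr => t _.
by rewrite -weighted_sum_node.
Qed.

End Numerical.

(** * Expansion of the exact solution *)

Section Exact.
Context {R : realType} {d N : nat}.
Notation V := 'rV[R]_d.

Definition inv_density (t : ctree N) : R := (density t)%:R^-1.

Lemma is_derive_translate (y : R -> V) (a t : R) (dy : V) :
  is_derive (a + t) 1 y dy -> is_derive t 1 (fun s => y (a + s)) dy.
Proof.
move=> [dyt <-].
have E : (fun h : R => h^-1 *: (((fun s => y (a + s)) \o shift t) (h *: 1)
           - y (a + t))) =
  (fun h : R => h^-1 *: ((y \o shift (a + t)) (h *: 1) - y (a + t))).
  by apply/funext => h /=; rewrite addrCA.
by apply: DeriveDef; rewrite ?/derivable /derive E.
Qed.

Lemma near_right_interval (P : R -> Prop) :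
  (\forall h \near 0^'+, P h) ->
  \forall h \near 0^'+, forall t, t \in `]0, h[%R -> P t.
Proof.
move=> [e /= e0 He]; near=> h.
have he : h < e by near: h; exact: nbhs_right_lt.
move=> t; rewrite in_itv/= => /andP[t0 th].
by apply: He => //=; rewrite sub0r normrN gtr0_norm// (lt_trans th).
Unshelve. all: by end_near. Qed.

(** The interval ]0, h[ lies in the region where the bound on dF holds as soon
as h does, and on it t^n <= h^n. *)
Lemma bigOX_primitive n (F dF : R -> V) : F 0 = 0 ->
  (\forall t \near 0, is_derive (t : R) 1 F (dF t)) ->
  bigOX n dF -> bigOX n.+1 F.
Proof.
move=> F0 /nbhs_norm0P[e /= e0 He] /bigOXP[C C0 dFC].
apply: (@bigOX_bound _ _ _ _ C); near=> h.
have h0 : 0 < h by [].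
have he : h < e by near: h; exact: nbhs_right_lt.
have dFh : forall t, t \in `]0, h[%R -> `|dF t| <= C * t ^+ n.
  by near: h; exact: near_right_interval.
rewrite -[F h]subr0 -[X in _ - X]F0 exprSr mulrA -[X in _ * X]subr0.
apply: (@mean_value_le R d F dF 0 h (C * h ^+ n) (ltW h0)) => t tI.
  apply: He; move: tI; rewrite in_itv/= => /andP[t0 th].
  by rewrite ger0_norm// (le_lt_trans th).
rewrite (le_trans (dFh t tI))//; move: tI; rewrite in_itv/= => /andP[t0 th].
by rewrite ler_wpM2l ?(ltW C0)// lerXn2r ?nnegrE ?ltW.
Unshelve. all: by end_near. Qed.

Variables (f : 'I_N -> V -> V) (y : R -> V) (tn : R).
Hypothesis y_exact : exact_solution_near f tn y.

(** The recursion of the density in the form produced by differentiating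
h^|tau| / gamma(tau). *)
Lemma inv_density_CNode mu (ts : seq (ctree N)) :
  (tree_size (CNode mu ts))%:R * inv_density (CNode mu ts) =
  \prod_(t <- ts) inv_density t.
Proof.
rewrite /inv_density /= natrM invfM mulVKf; last by rewrite pnatr_eq0.
by rewrite big_map natr_prod prodfV.
Qed.

Lemma exact_near : bigOX 1 (fun h => y (tn + h) - y tn).
Proof.
have [dy _] := nbhs_singleton y_exact.
have /cvg_ex[l /cvgrPdist_le/(_ 1 ltr01)[e /= e0 He]] := dy.
apply: (@bigOX_bound _ _ _ _ (1 + `|l|)); near=> h.
have h0 : 0 < h by [].
have he : h < e by near: h; exact: nbhs_right_lt.
have := He h; rewrite /= sub0r normrN gtr0_norm// => /(_ he (lt0r_neq0 h0)).
have -> : h%:A + tn = tn + h by rewrite addrC; congr (_ + _); exact: mulr1.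
move=> Hl; rewrite expr1 -[_ - _](@scalerKV _ _ h)// ?gt_eqF//.
rewrite normrZ gtr0_norm//.
rewrite mulrC ler_wpM2r ?(ltW h0)//.
set w := _ *: _ in Hl *.
rewrite -[w](subrK l) (le_trans (ler_normD _ _))// lerD2r.
by rewrite distrC.
Unshelve. all: by end_near. Qed.

Lemma is_derive_bseries q (c : ctree N -> R) x (t : R) :
  is_derive t 1 (bseries f x q.+1 c)
    (\sum_(nu < N) \sum_(ts <- words_upto (trees N q) q)
      (t ^+ sumn (map (@tree_size N) ts) * tree_coef (CNode nu ts) *
        ((tree_size (CNode nu ts))%:R * c (CNode nu ts))) *:
        elem_diff f (CNode nu ts) x).
Proof.
(* The exponent is a successor, as the rule for powers requires. *)
pose G (tr : ctree N) (h : R) := h ^+ (tree_size tr).-1.+1 *: elem_diff f tr x.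
pose dG (tr : ctree N) :=
  ((tree_size tr)%:R * t ^+ (tree_size tr).-1) *: elem_diff f tr x.
rewrite [X in is_derive _ _ X _](_ : _ = fun h => \sum_(tr <- trees N q.+1)
    (tree_coef tr * c tr) *: G tr h); last first.
  apply/funext => h; apply: eq_bigr => -[mu ts] _.
  rewrite /G scalerA [in RHS]mulrC; congr (_ *: _); exact: (esym (mulrA _ _ _)).
rewrite [X in is_derive _ _ _ X](_ : _ = \sum_(tr <- trees N q.+1)
    (tree_coef tr * c tr) *: dG tr); last first.
  rewrite treesS big_allpairs_dep; apply: eq_bigr => mu _.
  apply: eq_bigr => ts _; rewrite /dG scalerA; congr (_ *: _).
  have rearr (u a b v : R) : (u * a) * (b * v) = (a * v) * (b * u) by ring.
  exact: rearr.
apply: (is_derive_sumZ (P := xpredT)) => [|[mu ts] _]; first exact: all_predT.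
exact: is_derive_powZ.
Qed.

(** The derivative of y(tn + h) is the sum of the f^[nu](y(tn + h)), which
[bseries_comp] expands to order q + 1; term by term this is the derivative of
the claimed expansion, so the derivative of the difference is O(h^(q+1)) and
the difference itself O(h^(q+2)). *)
Lemma exact_expansion q :
  (forall nu, class_C q (f nu)) -> (forall nu, lipschitz (f nu)) ->
  bigOX q.+1 (fun h => y (tn + h) - y tn - bseries f (y tn) q inv_density h).
Proof.
move=> + fL; elim: q => [_|q IHq fC].
  apply: (bigOX_near _ exact_near); apply: nearW => h.
  by rewrite /bseries big_nil subr0.
have fC' nu : class_C q (f nu) by exact/class_CS/fC.
pose S (t : R) := \sum_(nu < N) \sum_(ts <- words_upto (trees N q) q)
      (t ^+ sumn (map (@tree_size N) ts) * tree_coef (CNode nu ts) *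
        ((tree_size (CNode nu ts))%:R * inv_density (CNode nu ts))) *:
        elem_diff f (CNode nu ts) (y tn).
apply: (@bigOX_primitive _ _ (fun h => rhs f (y (tn + h)) - S h)).
- rewrite addr0 subrr sub0r /bseries big1 ?oppr0// => -[mu ts] _.
  by rewrite /= expr0n /= !mul0r scale0r.
- move: y_exact; rewrite /exact_solution_near => /nbhs_normP[e /= e0 He].
  apply/nbhs_norm0P; exists e => //= t te.
  apply: is_deriveB; last exact: is_derive_bseries.
  rewrite -[X in is_derive _ _ _ X]subr0; apply: is_deriveB.
  apply: is_derive_translate; apply: He => /=.
  by rewrite opprD addNKr normrN.
- have YO := IHq fC'.
  have comp nu := bseries_comp (fC nu) (fL nu)
    (fun t => bigOX_cst (inv_density t)) YO.
  have := bigOX_sum (index_enum 'I_N) (P := xpredT) (fun nu _ => comp nu).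
  apply: bigOX_near; apply: nearW => h.
  rewrite sumrB; congr (_ - _); apply: eq_bigr => nu _; apply: eq_bigr => ts _.
  by rewrite inv_density_CNode.
Qed.

End Exact.

(** * Ordered representatives of an unordered tree *)

Section SameTree.
Context {N : nat}.
Implicit Types t : ctree N.

Lemma same_tree_sym t t' : same_tree t t' -> same_tree t' t.
Proof.
elim=> [?|t1 t2 t3 _ t21 _ t32|mu s1 s2 t1 t2|mu s1 s2 t1 t2 _ t21].
- exact: same_refl.
- exact: same_trans t32 t21.
- exact: same_swap.
- exact: same_child.
Qed.

Lemma same_tree_size t t' : same_tree t t' -> tree_size t = tree_size t'.
Proof.
elim=> [//|t1 t2 t3 _ -> _ //|mu s1 s2 t1 t2|mu s1 s2 t1 t2 _ E] /=.
  by rewrite !map_cat !sumn_cat/=; congr (_ + _).+1; exact: addnCA.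
by rewrite !map_cat !sumn_cat/= E.
Qed.

Lemma density_CNode mu (ts : seq (ctree N)) : density (CNode mu ts) =
  (tree_size (CNode mu ts) * \prod_(t <- ts) density t)%N.
Proof. by rewrite /= big_map. Qed.

Lemma same_tree_density t t' : same_tree t t' -> density t = density t'.
Proof.
elim=> [//|t1 t2 t3 _ -> _ //|mu s1 s2 t1 t2|mu s1 s2 t1 t2 st E].
  have /same_tree_size sz := same_swap mu s1 s2 t1 t2.
  rewrite !density_CNode sz !big_cat !big_cons.
  by congr (_ * (_ * _))%N; exact: mulnCA.
have /same_tree_size sz := same_child mu s1 s2 st.
by rewrite !density_CNode sz !big_cat !big_cons E.
Qed.

Lemma same_tree_stage_weight (R : realType) (s : nat)
    (A : 'I_N -> 'M[R]_s) t t' :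
  same_tree t t' -> stage_weight A t = stage_weight A t'.
Proof.
elim=> [//|t1 t2 t3 _ -> _ //|mu s1 s2 t1 t2|mu s1 s2 t1 t2 st E];
  apply/funext => nu; apply/funext => i;
  rewrite /= !map_cat !big_cat !big_cons/=.
  by congr (_ * (_ * _)); exact: mulrCA.
by rewrite E.
Qed.

Lemma same_tree_step_weight (R : realType) (s : nat) (A : 'I_N -> 'M[R]_s)
  (b : 'I_N -> 'rV[R]_s) t t' :
  same_tree t t' -> step_weight A b t = step_weight A b t'.
Proof. by move=> tt'; rewrite /step_weight (same_tree_stage_weight A tt'). Qed.

Lemma elem_diff_CNode (R : realType) (d : nat)
    (f : 'I_N -> 'rV[R]_d -> 'rV[R]_d) mu ts x :
  elem_diff f (CNode mu ts) x =
  iter_derive (f mu) [seq elem_diff f t x | t <- ts] x.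
Proof. by []. Qed.

(** Exchanging two adjacent children exchanges two successive directions of
differentiation. The bound on the size bounds the number of children, so that f
is smooth enough for [iter_derive_swap]. *)
Lemma same_tree_elem_diff (R : realType) (d p : nat)
    (f : 'I_N -> 'rV[R]_d -> 'rV[R]_d) x t t' :
  (forall nu, class_C p (f nu)) -> same_tree t t' -> (tree_size t <= p)%N ->
  elem_diff f t x = elem_diff f t' x.
Proof.
move=> fC; elim=> [//|t1 t2 t3 t12 IH12 _ IH23 t1p|mu s1 s2 t1 t2 tp|
  mu s1 s2 t1 t2 st IH tp].
- by rewrite IH12 ?IH23// -(same_tree_size t12).
- rewrite !elem_diff_CNode !map_cat/=.
  rewrite iter_derive_swap// !size_map; apply: class_C_le (fC mu).
  apply: leq_trans tp; rewrite /= map_cat sumn_cat/=.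
  have size_le s : (size s <= sumn (map (@tree_size N) s))%N.
    by elim: s => //= -[nu us] ts IHts; rewrite -add1n leq_add.
  apply: leqW; rewrite leq_add// -add2n addnA leq_add//.
  by case: t1 => ? ?; case: t2 => ? ?; rewrite /= addSn addnS.
- rewrite !elem_diff_CNode !map_cat/= IH//.
  by apply: leq_trans tp; rewrite /= map_cat sumn_cat/= addnCA -addnS leq_addr.
Qed.

(** Choice applied to the class of t, which is the same set for all its
members. *)
Lemma tree_canon : exists canon : ctree N -> ctree N,
  (forall t, same_tree t (canon t)) /\
  (forall t t', same_tree t t' -> canon t = canon t').
Proof.
pose sel (S : ctree N -> Prop) (H : exists t, S t) := sval (cid H).
exists (fun t => sel (same_tree t) (ex_intro _ t (same_refl t))).
split=> [t|t t' tt'].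
  exact: svalP (cid _).
have E : same_tree t = same_tree t'.
  apply/funext => t''; apply/propext; split; apply: same_trans => //.
  exact: same_tree_sym.
(* The two choices differ only in the proof that the class is inhabited. *)
move: (ex_intro _ t _) (ex_intro _ t' _); rewrite E => H H'.
by rewrite (Prop_irrelevance H H').
Qed.

Lemma sum_canon (R : realType) (W : lmodType R) (L : seq (ctree N))
    (canon : ctree N -> ctree N) (a : ctree N -> R) (G : ctree N -> W) :
  {in L, forall t, G t = G (canon t)} ->
  \sum_(t <- L) a t *: G t =
  \sum_(r <- undup (map canon L)) (\sum_(t <- L | canon t == r) a t) *: G r.
Proof.
move=> Gc; under [RHS]eq_bigr do rewrite scaler_suml.
rewrite (exchange_big_dep xpredT)//= [LHS]big_seq [RHS]big_seq.
apply: eq_bigr => t tL; under eq_bigl do rewrite eq_sym.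
rewrite -big_filter filter_pred1_uniq ?undup_uniq ?mem_undup ?map_f//.
by rewrite big_seq1 Gc.
Qed.

End SameTree.

(** * Order conditions *)

(** Coordinates with respect to a free family are linear functionals of a
finite-dimensional space, hence bounded. *)
Lemma bigOX_coord (R : realType) (d m n : nat) (X : m.-tuple 'rV[R]_d)
    (c : 'I_m -> R -> R) k :
  free X -> bigOX n (fun h => \sum_(i < m) c i h *: X`_i) -> bigOX n (c k).
Proof.
move=> freeX cO.
apply: (bigOX_dom (K := \sum_(j < d) `|coord X k (delta_mx 0 j)|) _ cO).
apply: nearW => h; rewrite -[c k h](coord_sum_free (fun i => c i h) k freeX).
set v := \sum_(i < m) _; rewrite {1}[v]row_sum_delta linear_sum.
rewrite (le_trans (ler_norm_sum _ _ _))// mulr_suml; apply: ler_sum => j _.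
by rewrite linearZ normrM mulrC ler_wpM2l// coord_norm_le.
Qed.

Lemma bigOX_mulX (R : realType) m n (g : R -> R) :
  bigOX (m + n) (fun h => h ^+ m * g h) <-> bigOX n g.
Proof.
split=> [/bigOXP[C C0 gC]|]; last exact: bigOXM (bigOX_exp m).
apply: (@bigOX_bound _ _ _ _ C); near=> h.
have hm : 0 < h ^+ m by rewrite exprn_gt0.
rewrite -(ler_pM2l hm) -[h ^+ m in leLHS]gtr0_norm// -normrM mulrCA -exprD.
by near: h.
Unshelve. all: by end_near. Qed.

Section Order.
Context {R : realType} {d N s p : nat}.
Notation V := 'rV[R]_d.
Variables (f : 'I_N -> V -> V).
Hypothesis f_smooth : forall nu, class_C p.+1 (f nu).
Hypothesis f_lipschitz : forall nu, lipschitz (f nu).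
Variables (A : 'I_N -> V -> R -> 'M[R]_s) (b : 'I_N -> V -> R -> 'rV[R]_s).
Variables (y : R -> V) (tn : R).
Hypothesis y_exact : exact_solution_near f tn y.
Hypothesis A_bounded :
  forall nu i j, is_bigO (fun h => A nu (y tn) h i j) (fun=> 1).
Hypothesis b_bounded :
  forall nu j, is_bigO (fun h => b nu (y tn) h 0 j) (fun=> 1).

Definition order_defect (t : ctree N) (h : R) : R :=
  step_weight (fun nu => A nu (y tn) h) (fun nu => b nu (y tn) h) t
  - inv_density t.

Definition defect_term (h : R) (t : ctree N) : V :=
  (h ^+ tree_size t * order_defect t h) *: elem_diff f t (y tn).

Lemma order_defect_O0 t : bigOX 0 (order_defect t).
Proof.
apply: bigOXB; last exact: bigOX_cst.
exact: (bigOX_weighted_sum (A := fun h nu => A nu (y tn) h)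
  (om := fun h nu j => b nu (y tn) h 0 j)).
Qed.

(** Both expansions are taken one order further than needed, over
[trees N p.+1]; its trees with more than p nodes contribute O(h^(p+1)) since u
is bounded. *)
Lemma local_error (ynext : R -> V) :
  (\forall h \near 0^'+, nsark_step f A b (y tn) h (ynext h)) ->
  bigOX p.+1 (fun h => ynext h - y (tn + h) -
    \sum_(t <- trees N p.+1 | (tree_size t <= p)%N)
       tree_coef t *: defect_term h t).
Proof.
move=> step.
have /choice[Y YP] : forall h, exists Y : 'I_s -> V,
    nsark_step f A b (y tn) h (ynext h) ->
    stage_equations f A (y tn) h Y /\
    ynext h = y tn +
      h *: \sum_(j < s) \sum_(nu < N) b nu (y tn) h 0 j *: f nu (Y j).
  move=> h; have [[Y YE ynE]|nostep] :=
    pselect (nsark_step f A b (y tn) h (ynext h)).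
    by exists Y.
  by exists (fun=> 0).
have YE : \forall h \near 0^'+, forall i, Y h i = y tn +
    h *: \sum_(j < s) \sum_(nu < N) A nu (y tn) h i j *: f nu (Y h j).
  by apply: filterS step => h /YP[].
have num := @step_expansion R d N s f (y tn) f_lipschitz
  (fun h nu => A nu (y tn) h) Y A_bounded YE p
  (fun h nu => b nu (y tn) h) f_smooth b_bounded.
have exa := exact_expansion y_exact f_smooth f_lipschitz.
have high : bigOX p.+1 (fun h =>
    \sum_(t <- trees N p.+1 | ~~ (tree_size t <= p)%N)
      tree_coef t *: defect_term h t).
  apply: bigOX_sum => t; rewrite -ltnNge => pt.
  apply: (@bigOXZ _ _ 0 p.+1 (fun=> tree_coef t)); first exact: bigOX_cst.
  rewrite -[p.+1]addn0; apply: (@bigOXZ _ _ _ 0); last exact: bigOX_cst.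
  rewrite -[p.+1]addn0; apply: bigOXM; last exact: order_defect_O0.
  by apply: bigOX_le (bigOX_exp _).
have := bigOXD (bigOX_le (leqnSn p.+1) (bigOXB num exa)) high.
apply: bigOX_near; near=> h.
have [_ ->] : stage_equations f A (y tn) h (Y h) /\
    ynext h = y tn +
      h *: \sum_(j < s) \sum_(nu < N) b nu (y tn) h 0 j *: f nu (Y h j).
  by apply: YP; near: h.
have -> : \sum_(t <- trees N p.+1 | (tree_size t <= p)%N)
       tree_coef t *: defect_term h t =
  bseries f (y tn) p.+1
    (step_weight (fun nu => A nu (y tn) h) (fun nu => b nu (y tn) h)) h
  - bseries f (y tn) p.+1 inv_density h
  - \sum_(t <- trees N p.+1 | ~~ (tree_size t <= p)%N)
    tree_coef t *: defect_term h t.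
  apply/eqP; rewrite eq_sym subr_eq; apply/eqP.
  transitivity (\sum_(t <- trees N p.+1)
    tree_coef t *: defect_term h t).
    rewrite /bseries -sumrB; apply: eq_bigr => t _.
    rewrite /defect_term /order_defect -scalerBl scalerA.
    by congr (_ *: _); ring.
  exact: bigID.
set B1 := bseries _ _ _ _ _; set B2 := bseries _ _ _ _ _.
set S := \sum_(j < s) _; set T := \sum_(t <- _ | _) _.
have rearr (u v w b1 b2 r : V) :
    w - b1 - (v - u - b2) + r = u + w - v - (b1 - b2 - r).
  by apply/rowP => i; rewrite !mxE; ring.
exact: rearr.
Unshelve. all: by end_near. Qed.

Lemma order_conditions_sufficient :
  order_conditions A b p (y tn) -> order_at_least f A b p y tn.
Proof.
move=> cond ynext /local_error err.
have low : bigOX p.+1 (fun h => \sum_(t <- trees N p.+1 | (tree_size t <= p)%N)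
    tree_coef t *: defect_term h t).
  apply: bigOX_sum => t tp.
  apply: (@bigOXZ _ _ 0 p.+1 (fun=> tree_coef t)); first exact: bigOX_cst.
  rewrite -[p.+1]addn0; apply: (@bigOXZ _ _ _ 0); last exact: bigOX_cst.
  rewrite -(subnKC (leqW tp)); apply/bigOX_mulX; exact: cond.
by apply: (bigOX_near _ (bigOXD err low)); apply: nearW => h; rewrite subrK.
Qed.

(** Solvability provides a family of steps to which the order hypothesis
applies. Equal summands are collected on one representative per unordered tree,
with a coefficient beta > 0, and the independence of the elementary
differentials isolates the summands. *)
Lemma order_conditions_necessary :
  (\forall h \near 0^'+, exists Y, stage_equations f A (y tn) h Y) ->
  independent_elem_diffs f p (y tn) ->
  order_at_least f A b p y tn -> order_conditions A b p (y tn).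
Proof.
move=> solvable indep order.
have /choice[ynext ynextP] : forall h, exists yn1,
    (exists Y, stage_equations f A (y tn) h Y) -> nsark_step f A b (y tn) h yn1.
  move=> h; have [[Y YE]|noY] :=
    pselect (exists Y, stage_equations f A (y tn) h Y).
    by eexists; exists Y.
  by exists 0.
have step : \forall h \near 0^'+, nsark_step f A b (y tn) h (ynext h).
  by apply: filterS solvable => h; exact: ynextP.
have := bigOXB (order _ step) (local_error step).
pose L := [seq t <- trees N p.+1 | (tree_size t <= p)%N].
have [canon [canonS canonE]] := @tree_canon N.
have Lp t : t \in L -> (tree_size t <= p)%N by rewrite mem_filter => /andP[].
have canonp t : (tree_size (canon t) <= p)%N = (tree_size t <= p)%N.
  by rewrite -(same_tree_size (canonS t)).
have defectE t : order_defect (canon t) = order_defect t.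
  apply/funext => h; rewrite /order_defect /inv_density.
  rewrite -(same_tree_density (canonS t)).
  by rewrite -(same_tree_step_weight _ _ (canonS t)).
have GE h : {in L, forall t, defect_term h t = defect_term h (canon t)}.
  move=> t /Lp tp; rewrite /defect_term defectE -(same_tree_size (canonS t)).
  have fC nu : class_C p (f nu) by exact/class_CS/f_smooth.
  by rewrite -(same_tree_elem_diff _ fC (canonS t) tp).
pose T := undup (map canon L).
pose beta r : R := \sum_(t <- L | canon t == r) tree_coef t.
pose tr (k : 'I_(size T)) := tnth (in_tuple T) k.
have trT k : exists2 t, t \in L & tr k = canon t.
  have : tr k \in T by exact: mem_tnth.
  by rewrite mem_undup => /mapP.
have free_tr : free [tuple elem_diff f (tr k) (y tn) | k < size T].
  apply: indep => [k|k l].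
    by have [t tL ->] := trT k; rewrite canonp; exact: Lp.
  have [t tL trk] := trT k; have [t' t'L trl] := trT l.
  rewrite trk trl => /canonE.
  (* canon is constant on classes, hence idempotent. *)
  rewrite -(canonE _ _ (canonS t)) -(canonE _ _ (canonS t')) -trk -trl => E.
  by have /tuple_uniqP/(_ _ _ E) : uniq (in_tuple T) by exact: undup_uniq.
move=> errO.
have {}errO : bigOX p.+1 (fun h => \sum_(k < size T)
    (beta (tr k) * (h ^+ tree_size (tr k) * order_defect (tr k) h)) *:
      [tuple elem_diff f (tr k) (y tn) | k < size T]`_k).
  apply: (bigOX_near _ errO); apply: nearW => h.
  rewrite opprB addrC subrK -big_filter -/L.
  rewrite (sum_canon _ (GE h)) -/T big_tnth; apply: eq_bigr => k _.
  by rewrite -tnth_nth tnth_mktuple scalerA.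
move=> t tp; have tL : t \in L.
  by rewrite mem_filter tp andTb; apply: mem_trees; exact: leqW.
have [k trk] : exists k, tr k = canon t.
  have : canon t \in in_tuple T by rewrite mem_undup map_f.
  by move=> /tnthP[k kE]; exists k.
have beta0 : beta (tr k) != 0.
  rewrite gt_eqF// /beta trk -big_filter.
  have : t \in [seq t' <- L | canon t' == canon t] by rewrite mem_filter eqxx.
  case: [seq t' <- L | _] => // t1 ts _; rewrite big_cons.
  rewrite ltr_wpDr ?tree_coef_gt0// sumr_ge0// => t2 _.
  by rewrite ltW ?tree_coef_gt0.
have := @bigOXM _ 0 _ _ _ (bigOX_cst (beta (tr k))^-1)
  (bigOX_coord k free_tr errO).
rewrite add0n -{1}(subnKC (leqW tp)) => defO; apply/(bigOX_mulX (tree_size t)).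
apply: (bigOX_near _ defO); apply: nearW => h.
by rewrite mulKf// trk defectE -(same_tree_size (canonS t)).
Qed.

End Order.

Theorem corollary4p2 (R : realType) (d N s p : nat)
    (f : 'I_N -> 'rV[R]_d -> 'rV[R]_d)
    (f_smooth : forall nu, class_C p.+1 (f nu))
    (f_lipschitz : forall nu, lipschitz (f nu))
    (A : 'I_N -> 'rV[R]_d -> R -> 'M[R]_s)
    (b : 'I_N -> 'rV[R]_d -> R -> 'rV[R]_s)
    (y : R -> 'rV[R]_d) (tn : R)
    (y_exact : exact_solution_near f tn y)
    (A_bounded : forall nu i j,
       is_bigO (fun h => A nu (y tn) h i j) (fun=> 1))
    (b_bounded : forall nu j,
       is_bigO (fun h => b nu (y tn) h 0 j) (fun=> 1))
    (stages_solvable : \forall h \near 0^'+,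
       exists Y, stage_equations f A (y tn) h Y) :
  (independent_elem_diffs f p (y tn) ->
     (order_at_least f A b p y tn <-> order_conditions A b p (y tn)))
  /\ (order_conditions A b p (y tn) -> order_at_least f A b p y tn).
Proof.
have sufficient : order_conditions A b p (y tn) -> order_at_least f A b p y tn.
  exact: order_conditions_sufficient.
split=> // indep; split=> //.
exact: order_conditions_necessary.
Qed.
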